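(* Let $n\ge 1$, let $0\le \epsilon\le \tfrac12$, and let $f:\{0,1\}^n\to\mathbb{R}$ be a nonnegative function that is not identically zero. (i) For every integer $q\ge 2$, \[ \ln \|T_{\epsilon} f\|_q ~\le~ \mathbb{E}_{T \sim \lambda}\, \ln \| \mathbb{E}(f|T)\|_q , \qquad\text{where } \lambda=\lambda(q,\epsilon) = 1 + \frac{1}{q-1}\log_2\!\big(\epsilon^q + (1-\epsilon)^q\big). \] (ii) Also \[ \ln \|T_{\epsilon} f\|_{\infty} ~\le~ \mathbb{E}_{T \sim \lambda}\, \ln \| \mathbb{E}(f|T)\|_{\infty}, \qquad\text{where } \lambda=\lambda(\infty,\epsilon) = 1 + \log_2(1-\epsilon). \] (iii) Both inequalities hold with equality whenever $f$ is the characteristic function of a (nonempty) subcube of $\{0,1\}^n$.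
   Context: Norms are with respect to the uniform probability measure on $\{0,1\}^n$: $\|g\|_q=(\mathbb{E}_x |g(x)|^q)^{1/q}$ and $\|g\|_\infty=\max_x|g(x)|$. For $0\le\epsilon\le\tfrac12$, the noise operator is $(T_\epsilon f)(x)=\sum_{y\in\{0,1\}^n}\epsilon^{|y-x|}(1-\epsilon)^{n-|y-x|}f(y)$, where $|y-x|$ is the Hamming distance; equivalently $(T_\epsilon f)(x)=\mathbb{E} f(y)$ where each coordinate $y_i$ equals $x_i$ with probability $1-\epsilon$ and $1-x_i$ with probability $\epsilon$, independently. For $0\le\lambda\le1$, $T\sim\lambda$ denotes a random subset $T\subseteq[n]$ containing each element independently with probability $\lambda$. For $T\subseteq[n]$, the conditional expectation $\mathbb{E}(f|T)$ is the function on $\{0,1\}^n$ given by $\mathbb{E}(f|T)(x)=\mathbb{E}_{y:\,y|_T=x|_T} f(y)$ (uniform average over $y$ agreeing with $x$ on the coordinates in $T$). A subcube is a set of the form $\{x\in\{0,1\}^n: x_i=a_i \text{ for all } i\in K\}$ for some $K\subseteq[n]$ and $a\in\{0,1\}^K$. *)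

(* Defs.v *)
From HB Require Import structures.
From mathcomp Require Import all_boot all_order all_algebra.
From mathcomp Require Import reals exp.
Set Implicit Arguments. Unset Strict Implicit. Unset Printing Implicit Defensive.
Import Order.TTheory GRing.Theory Num.Theory.
Local Open Scope ring_scope.

Definition cube (n : nat) := {ffun 'I_n -> bool}.

Section Defs.
Variable R : realType.
Variable n : nat.

Definition cmean (g : cube n -> R) : R := (\sum_(x : cube n) g x) / (#|{: cube n}|)%:R.

Definition qnorm (q : nat) (g : cube n -> R) : R :=
  powR (cmean (fun x => `|g x| ^+ q)) (q%:R)^-1.

Definition infnorm (g : cube n -> R) : R := \big[Num.max/0]_(x : cube n) `|g x|.

Definition hamming (x y : cube n) : nat := #|[set i | x i != y i]|.

Definition noise (eps : R) (f : cube n -> R) (x : cube n) : R :=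
  \sum_(y : cube n) eps ^+ hamming y x * (1 - eps) ^+ (n - hamming y x) * f y.

Definition agree (T : {set 'I_n}) (x : cube n) : {set cube n} :=
  [set y : cube n | [forall i in T, y i == x i]].
Definition condexp (f : cube n -> R) (T : {set 'I_n}) (x : cube n) : R :=
  (\sum_(y in agree T x) f y) / (#|agree T x|)%:R.

(* E_{T ~ lambda} G(T): T random subset with each element independently w.p. lambda. *)
Definition Esub (lam : R) (G : {set 'I_n} -> R) : R :=
  \sum_(T : {set 'I_n}) lam ^+ #|T| * (1 - lam) ^+ (n - #|T|) * G T.

Definition subcube_ind (K : {set 'I_n}) (a : cube n) (x : cube n) : R :=
  if [forall i in K, x i == a i] then 1 else 0.
End Defs.

Definition log2 {R : realType} (x : R) : R := ln x / ln 2.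

Definition lam_q {R : realType} (q : nat) (eps : R) : R :=
  1 + (q%:R - 1)^-1 * log2 (eps ^+ q + (1 - eps) ^+ q).

Definition lam_inf {R : realType} (eps : R) : R := 1 + log2 (1 - eps).

(* Main.v *)
(** Noise acts one coordinate at a time, so it suffices to treat one coordinate:
    for [g >= 0], with [N_i] the noise and [E_i] the averaging in direction [i],
    [ln |N_i g| <= l ln |g| + (1 - l) ln |E_i g|]. Replacing the coordinates of
    the noise one by one by "keep with probability [l], otherwise average"
    then gives the theorem. By Hölder's inequality the one-coordinate bound
    follows from the case where [g] is a function of a single bit, which after
    normalization reads [ln phi(r t) ln phi(1) <= ln phi(r) ln phi(t)] for
    [r, t] in [[0, 1]], where [r = 1 - 2 eps] and
    [phi(t) = ((1 + t)^q + (1 - t)^q) / 2] (and [phi(t) = 1 + t] if [q] is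
    infinite). This holds because [t phi'(t) / phi(t)] is log-concave as a
    function of [ln t]: it equals [q w / (1 + w)] with
    [w = t tanh((q - 1) artanh t)]. On the indicator of a subcube, a coordinate
    is either free or pinned, and both are equality cases of the
    one-coordinate bound. *)
Require Import Defs.
From HB Require Import structures.
From mathcomp Require Import all_boot all_order all_algebra.
From mathcomp Require Import topology normedtype sequences derive realfun.
From mathcomp Require Import reals exp.
From mathcomp Require Import ring lra.
Import Order.TTheory GRing.Theory Num.Theory numFieldNormedType.Exports.
Local Open Scope ring_scope.

(** * Two-point inequality *)

Lemma MVT_is_derive (R : realType) (f df : R -> R) (a b : R) : a < b ->
  (forall x : R, a <= x <= b -> is_derive x 1 f (df x)) ->
  exists2 c : R, a < c < b & f b - f a = df c * (b - a).
Proof.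
move=> ab hd.
have [||c hc ->] := @MVT R f df a b ab; last by exists c.
- by move=> x; rewrite in_itv /= => /andP[h1 h2]; apply: hd; rewrite !ltW.
- apply: derivable_within_continuous => x; rewrite in_itv /= => hx.
  by have [] := hd x hx.
Qed.

Lemma is_derive_dilate (R : realType) (f : R -> R) (df c x : R) :
  is_derive (c * x) 1 f df -> is_derive x 1 (fun y => f (c * y)) (c * df).
Proof.
move=> hf; rewrite mulrC.
have hg : is_derive x 1 (fun y : R => c * y) c.
  by rewrite -[X in is_derive _ _ _ X]mulr1; apply: (@is_deriveZ _ _ _ id c).
exact: (is_derive1_comp hf hg).
Qed.

Lemma is_derive_ln_comp (R : realType) (f : R -> R) (df x : R) :
  0 < f x -> is_derive x 1 f df -> is_derive x 1 (fun y => ln (f y)) (df / f x).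
Proof.
move=> fx0 hf; rewrite mulrC.
exact: (is_derive1_comp (is_derive1_ln fx0) hf).
Qed.

(* The hypothesis says that [h] is log-concave as a function of [ln x]. *)
Lemma supermul_of_elasticity (R : realType) (h dh : R -> R) :
  (forall x : R, 0 < x < 1 -> 0 < h x) ->
  (forall x : R, 0 < x < 1 -> is_derive x 1 h (dh x)) ->
  (forall x y : R, 0 < x -> x <= y -> y < 1 ->
     y * (dh y / h y) <= x * (dh x / h x)) ->
  forall r s t : R, 0 < r <= 1 -> 0 < s -> s <= t -> t < 1 ->
    h (r * s) * h t <= h (r * t) * h s.
Proof.
move=> hpos hder hmon r s t /andP[r0 r1] s0 st t1.
have t0 : 0 < t by exact: lt_le_trans st.
have s1 : s < 1 by exact: le_lt_trans t1.
have dom (x c : R) : 0 < x -> x < 1 -> r <= c -> c <= 1 -> 0 < c * x < 1.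
  move=> x0 x1 rc c1; have c0 : 0 < c by exact: lt_le_trans rc.
  by rewrite mulr_gt0 //=; apply: le_lt_trans x1; rewrite ler_piMl // ltW.
have [->|rn1] := eqVneq r 1; first by rewrite !mul1r mulrC.
have rlt1 : r < 1 by rewrite lt_neqAle rn1.
(* [c * dF c] is the elasticity of [h] at [s * c] minus that at the larger point [t * c], so [F] is
   nondecreasing; [F r <= F 1] is the claim in logarithms. *)
pose F c := ln (h (s * c)) - ln (h (t * c)).
pose dF c := s * dh (s * c) / h (s * c) - t * dh (t * c) / h (t * c).
have Fder (c : R) : r <= c <= 1 -> is_derive c 1 F (dF c).
  move=> /andP[rc c1]; have c0 : 0 < c by exact: lt_le_trans rc.
  have dom' (x : R) : 0 < x -> x < 1 -> 0 < x * c < 1.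
    by move=> x0 x1; rewrite mulrC; apply: dom.
  apply: is_deriveB; apply: is_derive_ln_comp.
  - by apply: hpos; apply: dom'.
  - by apply: is_derive_dilate; apply: hder; apply: dom'.
  - by apply: hpos; apply: dom'.
  - by apply: is_derive_dilate; apply: hder; apply: dom'.
have [c /andP[rc c1] eqF] := MVT_is_derive _ _ _ _ _ rlt1 Fder.
have c0 : 0 < c by exact: lt_trans rc.
have dFc : 0 <= dF c.
  rewrite -(pmulr_rge0 _ c0) /dF mulrBr subr_ge0.
  have /andP[_ tc1] := dom t c t0 t1 (ltW rc) (ltW c1); rewrite mulrC in tc1.
  have le_c : s * c <= t * c by rewrite ler_wpM2r // ltW.
  by have := hmon (s * c) (t * c) (mulr_gt0 s0 c0) le_c tc1; lra.
have : F r <= F 1.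
  by rewrite -subr_ge0 eqF mulr_ge0 // subr_ge0.
have /andP[p1 p2] := dom s r s0 s1 (lexx _) r1.
have /andP[p3 p4] := dom t r t0 t1 (lexx _) r1.
have hs : 0 < h s by rewrite hpos // s0.
have ht : 0 < h t by rewrite hpos // t0.
have hrs : 0 < h (r * s) by rewrite hpos // p1.
have hrt : 0 < h (r * t) by rewrite hpos // p3.
rewrite /F !mulr1 ![_ * r]mulrC lerBlDr addrAC lerBrDr -!lnM ?posrE //.
by rewrite ler_ln ?posrE ?mulr_gt0 // [h s * _]mulrC.
Qed.

(** With [E(x) = x p'(x) / p(x)], the last hypothesis on [p] makes [E(r x) / E(x)] nondecreasing.
    This is the quotient of the derivatives of [ln p(r x)] and [ln p(x)], so [ln p(r x)] minus a
    constant multiple of [ln p(x)] can only fall first and then rise. *)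
Lemma ln_dilate_le (R : realType) (p : {poly R}) (r t : R) :
  p.[0] = 1 ->
  (forall x : R, 0 <= x <= 1 -> 0 < p.[x]) ->
  (forall x : R, 0 < x < 1 -> 0 < p^`().[x]) ->
  (forall x y : R, 0 < x -> x <= y -> y < 1 ->
    (r * x * p^`().[r * x] / p.[r * x]) * (y * p^`().[y] / p.[y])
     <= (r * y * p^`().[r * y] / p.[r * y]) * (x * p^`().[x] / p.[x])) ->
  0 <= r <= 1 -> 0 <= t <= 1 ->
  ln p.[r * t] * ln p.[1] <= ln p.[r] * ln p.[t].
Proof.
move=> p0 ppos dppos hP /andP[r0 r1] /andP[t0 t1].
have lnp1 : 0 < ln p.[1].
  have pder (x : R) : 0 <= x <= 1 -> is_derive x 1 (horner p) p^`().[x].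
    by move=> _; apply: is_derive_poly.
  have [c c01] := MVT_is_derive _ _ _ _ _ ltr01 pder.
  by rewrite subr0 mulr1 p0 => eqc; rewrite ln_gt0 // -subr_gt0 eqc dppos.
have [->|tn0] := eqVneq t 0; first by rewrite mulr0 !p0 ln1 mul0r mulr0.
have [->|tn1] := eqVneq t 1; first by rewrite mulr1.
have {tn0}t0 : 0 < t by rewrite lt_neqAle eq_sym tn0.
have {tn1}t1 : t < 1 by rewrite lt_neqAle tn1.
(* [D] vanishes at [0] and [1]; if [D t > 0], then [D' > 0] somewhere on the left of
   [t] and [D' < 0] somewhere on the right, against the hypothesis. *)
pose l := ln p.[r] / ln p.[1].
pose D x := ln p.[r * x] - l * ln p.[x].
pose dD x := r * p^`().[r * x] / p.[r * x] - l * (p^`().[x] / p.[x]).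
have dom (x : R) : 0 <= x -> x <= 1 -> 0 <= r * x <= 1.
  by move=> x0 x1; rewrite mulr_ge0 // mulr_ile1.
have Dder (x : R) : 0 <= x <= 1 -> is_derive x 1 D (dD x).
  move=> /andP[x0 x1]; apply: is_deriveB.
    apply: (@is_derive_ln_comp _ (fun y => p.[r * y])); first by rewrite ppos ?dom.
    by apply: (@is_derive_dilate _ (horner p)); apply: is_derive_poly.
  apply: (@is_deriveZ _ _ _ (fun y => ln p.[y])).
  apply: (@is_derive_ln_comp _ (horner p)); by rewrite ppos ?x0.
suff : D t <= 0.
  by rewrite /D subr_le0 /l mulrAC ler_pdivlMr.
rewrite leNgt; apply/negP => Dt.
have D0 : D 0 = 0 by rewrite /D mulr0 p0 ln1 mulr0 subr0.
have D1 : D 1 = 0 by rewrite /D mulr1 /l divfK ?subrr // gt_eqF.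
have Dder0 (x : R) : 0 <= x <= t -> is_derive x 1 D (dD x).
  by move=> /andP[x0 x1]; apply: Dder; rewrite x0 (le_trans x1) // ltW.
have Dder1 (x : R) : t <= x <= 1 -> is_derive x 1 D (dD x).
  by move=> /andP[x0 x1]; apply: Dder; rewrite x1 (le_trans _ x0) // ltW.
have [a /andP[a0 a1] eqa] := MVT_is_derive _ _ _ _ _ t0 Dder0.
have [b /andP[b0 b1] eqb] := MVT_is_derive _ _ _ _ _ t1 Dder1.
have {eqa}da : 0 < dD a.
  by rewrite -(pmulr_lgt0 _ (_ : 0 < t - 0)) ?subr0 // -[t in X in _ < X]subr0 -eqa D0 subr0.
have {eqb}db : dD b < 0.
  by rewrite -(pmulr_llt0 _ (_ : 0 < 1 - t)) ?subr_gt0 // -eqb D1 sub0r oppr_lt0.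
have aP : 0 < a < 1 by rewrite a0 (lt_trans a1).
have bP : 0 < b < 1 by rewrite b1 (lt_trans t0).
have ab : a <= b by rewrite ltW // (lt_trans a1).
have /andP[b0' _] := bP.
have Pa : 0 < a * p^`().[a] / p.[a].
  by rewrite divr_gt0 ?mulr_gt0 ?dppos ?ppos // !ltW //; case/andP: aP.
have Pb : 0 < b * p^`().[b] / p.[b].
  by rewrite divr_gt0 ?mulr_gt0 ?dppos ?ppos // !ltW.
have ha : l * (a * p^`().[a] / p.[a]) < r * a * p^`().[r * a] / p.[r * a].
  rewrite -subr_gt0; have -> : r * a * p^`().[r * a] / p.[r * a] - l * (a * p^`().[a] / p.[a])
    = a * dD a.
    by rewrite /dD; ring.
  by rewrite mulr_gt0.
have hb : r * b * p^`().[r * b] / p.[r * b] < l * (b * p^`().[b] / p.[b]).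
  rewrite -subr_lt0; have -> : r * b * p^`().[r * b] / p.[r * b] - l * (b * p^`().[b] / p.[b])
    = b * dD b.
    by rewrite /dD; ring.
  by rewrite pmulr_rlt0.
have := hP a b a0 ab b1; rewrite leNgt => /negP; apply.
rewrite -(ltr_pM2r Pa) in hb; rewrite -(ltr_pM2r Pb) in ha.
by apply: (lt_trans hb); apply: le_lt_trans ha; rewrite mulrAC.
Qed.

(** * The hyperbolic tangent of a multiple, in algebraic form *)

Lemma ler_add_inv (R : realFieldType) (u v : R) :
  1 <= u -> u <= v -> u + u^-1 <= v + v^-1.
Proof.
move=> u1 uv; have u0 : 0 < u by exact: lt_le_trans u1.
have v0 : 0 < v by exact: lt_le_trans uv.
rewrite -subr_ge0.
have -> : v + v^-1 - (u + u^-1) = (v - u) * (u * v - 1) / (u * v).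
  by field; rewrite !gt_eqF.
rewrite divr_ge0 ?mulr_ge0 ?subr_ge0 // ?(ltW u0) ?(ltW v0) //.
by rewrite mulr_ege1 // (le_trans u1).
Qed.

Lemma ler_expz_sym (R : realFieldType) (a b : nat) (z z' : R) :
  1 <= z -> z <= z' -> z ^+ a / z ^+ b + z ^+ b / z ^+ a
    <= z' ^+ a / z' ^+ b + z' ^+ b / z' ^+ a.
Proof.
move=> z1 zz'.
have z0 : 0 < z by exact: lt_le_trans z1.
have z'0 : 0 < z' by exact: lt_le_trans zz'.
wlog ba : a b / (b <= a)%N => [th|].
  case/orP: (leq_total b a) => h; first exact: th.
  by rewrite [leLHS]addrC [leRHS]addrC; exact: th.
have E (x : R) : 0 < x -> x ^+ a / x ^+ b + x ^+ b / x ^+ a = x ^+ (a - b) + (x ^+ (a - b))^-1.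
  by move=> x0; rewrite -[x ^+ b / _]invf_div -expfB_cond // gt_eqF.
by rewrite !E // ler_add_inv ?exprn_ege1 // lerXn2r ?nnegrE // ltW.
Qed.

(** For [z = exp u] with [u > 0] the sum is [sinh ((n + 1) u) / sinh u]. Adding it to its reversal
    groups the terms into pairs [z^k + z^(-k)], each nondecreasing for [z >= 1]. *)
Lemma ler_sum_expz_sym (R : realFieldType) (n : nat) (z z' : R) :
  1 <= z -> z <= z' -> \sum_(i < n.+1) z ^+ (n - i) / z ^+ i
    <= \sum_(i < n.+1) z' ^+ (n - i) / z' ^+ i.
Proof.
move=> z1 zz'.
have E (x : R) : 2 * \sum_(i < n.+1) x ^+ (n - i) / x ^+ i =
    \sum_(i < n.+1) (x ^+ (n - i) / x ^+ i + x ^+ i / x ^+ (n - i)).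
  rewrite big_split /= mulr2n mulrDl !mul1r; congr (_ + _).
  rewrite (reindex_inj rev_ord_inj) /=; apply: eq_bigr => i _.
  by rewrite subSS subKn // -ltnS.
rewrite -(ler_pM2l (_ : 0 < 2)) // !E.
by apply: ler_sum => i _; apply: ler_expz_sym.
Qed.

Lemma sum_expz_gt0 (R : realFieldType) (n : nat) (z : R) :
  0 < z -> 0 < \sum_(i < n.+1) z ^+ (n - i) / z ^+ i.
Proof.
move=> z0; rewrite big_ord_recl /= ltr_wpDr ?divr_gt0 ?exprn_gt0 //.
by apply: sumr_ge0 => i _; rewrite divr_ge0 ?exprn_ge0 ?(ltW z0).
Qed.

(* [tanhn m (tanh u) = tanh (m u)] *)
Definition tanhn (R : fieldType) (m : nat) (x : R) : R :=
  ((1 + x) ^+ m - (1 - x) ^+ m) / ((1 + x) ^+ m + (1 - x) ^+ m).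

Lemma tanhn_den_gt0 (R : realFieldType) (m : nat) (x : R) :
  0 <= x <= 1 -> 0 < (1 + x) ^+ m + (1 - x) ^+ m.
Proof.
move=> /andP[x0 x1]; rewrite ltr_wpDr ?exprn_ge0 ?exprn_gt0 ?subr_ge0 //.
by rewrite ltr_wpDr.
Qed.

Lemma tanhn_num_gt0 (R : realFieldType) (m : nat) (x : R) :
  0 < x <= 1 -> 0 < (1 + x) ^+ m.+1 - (1 - x) ^+ m.+1.
Proof.
move=> /andP[x0 x1]; rewrite subr_gt0 ltrXn2r // ?nnegrE ?subr_ge0 //.
by lra.
Qed.

Lemma tanhn_gt0 (R : realFieldType) (m : nat) (x : R) :
  0 < x <= 1 -> 0 < tanhn R m.+1 x.
Proof.
move=> /andP[x0 x1]; rewrite divr_gt0 ?tanhn_num_gt0 ?tanhn_den_gt0 ?x0 //.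
by rewrite ltW.
Qed.

Lemma ler_tanhn (R : realFieldType) (m : nat) (x y : R) :
  0 <= x -> x <= y -> y <= 1 -> tanhn R m x <= tanhn R m y.
Proof.
move=> x0 xy y1.
have x1 : x <= 1 by exact: le_trans y1.
have y0 : 0 <= y by exact: le_trans xy.
rewrite /tanhn ler_pdivrMr ?tanhn_den_gt0 ?x0 // mulrAC ler_pdivlMr ?tanhn_den_gt0 ?y0 //.
(* Cross-multiplied, the claim reduces to comparing these two powers. *)
have h : ((1 + x) * (1 - y)) ^+ m <= ((1 + y) * (1 - x)) ^+ m.
  by rewrite lerXn2r ?nnegrE ?mulr_ge0 //; lra.
by rewrite !exprMn in h; nra.
Qed.

Lemma is_derive_tanhn (R : realType) (m : nat) (x : R) : 0 < x < 1 ->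
  is_derive x 1 (tanhn R m.+1)
    (4 * m.+1%:R * ((1 + x) * (1 - x)) ^+ m
       / ((1 + x) ^+ m.+1 + (1 - x) ^+ m.+1) ^+ 2).
Proof.
move=> /andP[x0 x1].
pose P : {poly R} := (1 + 'X) ^+ m.+1; pose Q : {poly R} := (1 - 'X) ^+ m.+1.
have PE y : P.[y] = (1 + y) ^+ m.+1 by rewrite /P !hornerE.
have QE y : Q.[y] = (1 - y) ^+ m.+1 by rewrite /Q !hornerE.
have dPE : P^`().[x] = m.+1%:R * (1 + x) ^+ m.
  rewrite /P deriv_exp derivD derivX -polyC1 derivC add0r.
  by rewrite !hornerE hornerMn !hornerE mulr_natl.
have dQE : Q^`().[x] = - (m.+1%:R * (1 - x) ^+ m).
  rewrite /Q deriv_exp derivB derivX -polyC1 derivC sub0r mulN1r mulNrn.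
  by rewrite !hornerE hornerMn !hornerE mulr_natl.
clearbody P Q.
have B0 : (P + Q).[x] != 0.
  by rewrite hornerD PE QE gt_eqF // tanhn_den_gt0 // !ltW.
have -> : tanhn R m.+1 = (fun y => (P - Q).[y] * ((P + Q).[y])^-1).
  by apply: boolp.funext => y; rewrite /tanhn !hornerE PE QE.
have hB := is_deriveV B0 (is_derive_poly (P + Q) x).
apply: is_derive_eq (is_deriveM (is_derive_poly (P - Q) x) hB) _.

(* In [R] the scalings produced by the derivative rules are products, and a rational identity in the
   [m]-th powers remains. *)
change ((P - Q).[x] * (- (P + Q).[x] ^- 2 * (P + Q)^`().[x])
  + (P + Q).[x]^-1 * (P - Q)^`().[x] = 
  4 * m.+1%:R * ((1 + x) * (1 - x)) ^+ m
       / ((1 + x) ^+ m.+1 + (1 - x) ^+ m.+1) ^+ 2).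
move: B0; rewrite derivB derivD !(hornerD, hornerN) dPE dQE PE QE exprMn.
rewrite ![_ ^+ m.+1]exprS.
by move: ((1 + x) ^+ m) ((1 - x) ^+ m) => a b B0; field.
Qed.

(** Put [x = tanh u] and [M = m + 1]. The elasticity of [tanh (M u)] in [x] is
    [M sinh (2 u) / sinh (2 M u)], and [(1 + x) / (1 - x) = exp (2 u)] turns the quotient of
    hyperbolic sines into the sum. *)
Lemma tanhn_elasticity (R : realFieldType) (m : nat) (x : R) : 0 < x < 1 ->
  x * (4 * m.+1%:R * ((1 + x) * (1 - x)) ^+ m
       / ((1 + x) ^+ m.+1 + (1 - x) ^+ m.+1) ^+ 2 / tanhn R m.+1 x)
  = m.+1%:R / \sum_(i < m.+1)
      ((1 + x) / (1 - x)) ^+ (m - i) / ((1 + x) / (1 - x)) ^+ i.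
Proof.
move=> /andP[x0 x1].
have X0 : 0 < 1 + x by lra.
have Y0 : 0 < 1 - x by lra.
have S0 := sum_expz_gt0 _ m _ (divr_gt0 X0 Y0).
set S := \sum_(i < _) _ in S0 *.
(* The right side is a difference of [m.+1]-st powers of [(1 + x)^2] and [(1 - x)^2], whose own
   difference is [4 * x]. *)
have SE : S * ((1 + x) * (1 - x)) ^+ m * (4 * x)
    = ((1 + x) ^+ m.+1 - (1 - x) ^+ m.+1) * ((1 + x) ^+ m.+1 + (1 - x) ^+ m.+1).
  rewrite -subr_sqr -!exprM ![(m.+1 * 2)%N]mulnC !exprM subrXX.
  have -> : (1 + x) ^+ 2 - (1 - x) ^+ 2 = 4 * x by ring.
  rewrite [RHS]mulrC; congr (_ * _); rewrite /S big_distrl /=; apply: eq_bigr => i _.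
  have im : (i <= m)%N by rewrite -ltnS.
  have powE (y : R) : y ^+ m = y ^+ (m - i) * y ^+ i by rewrite -exprD subnK.
  rewrite ![_ ^+ 2 ^+ _]exprAC !expr_div_n exprMn (powE (1 + x)) (powE (1 - x)).
  move: (exprn_gt0 (m - i) X0) (exprn_gt0 i X0) (exprn_gt0 (m - i) Y0) (exprn_gt0 i Y0).
  move: (_ ^+ (m - i)) (_ ^+ i) (_ ^+ (m - i)) (_ ^+ i) => a b c d a0 b0 c0 d0.
  by field; rewrite !gt_eqF.
have A0 : 0 < (1 + x) ^+ m.+1 - (1 - x) ^+ m.+1 by rewrite tanhn_num_gt0 ?x0 ?ltW.
have B0 : 0 < (1 + x) ^+ m.+1 + (1 - x) ^+ m.+1 by rewrite tanhn_den_gt0 // !ltW.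
rewrite /tanhn; move: (_ - _ ^+ m.+1) (_ + _ ^+ m.+1) (_ ^+ m) (m.+1%:R) S S0 SE A0 B0.
move=> A B p k S S0 SE A0 B0.
have -> : x * (4 * k * p / B ^+ 2 / (A / B)) = k * (p * (4 * x)) / (A * B).
  by field; rewrite !gt_eqF.
have AB0 : A * B != 0 by rewrite mulf_neq0 ?gt_eqF.
have Sn0 : S != 0 by rewrite gt_eqF.
by apply/eqP; rewrite (eqr_div _ _ AB0 Sn0) -SE; apply/eqP; ring.
Qed.

(** The elasticity is nonincreasing: it is a constant over a nondecreasing function of
    [(1 + x) / (1 - x)], a quantity that is at least 1 and grows with [x]. *)
Lemma tanhn_supermul (R : realType) (m : nat) (r s t : R) :
  0 < r <= 1 -> 0 < s -> s <= t -> t < 1 ->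
  tanhn R m.+1 (r * s) * tanhn R m.+1 t <= tanhn R m.+1 (r * t) * tanhn R m.+1 s.
Proof.
apply: (supermul_of_elasticity R _ _ _ (is_derive_tanhn R m)).
  by move=> x /andP[x0 x1]; rewrite tanhn_gt0 // x0 ltW.
move=> x y x0 xy y1.
have y0 : 0 < y by exact: lt_le_trans xy.
have x1 : x < 1 by exact: le_lt_trans y1.
rewrite !tanhn_elasticity ?x0 ?y0 //.
have X0 : 0 < (1 + x) / (1 - x) by rewrite divr_gt0; lra.
have Y0 : 0 < (1 + y) / (1 - y) by rewrite divr_gt0; lra.
apply: ler_wpM2l => //; rewrite lef_pV2 ?posrE ?sum_expz_gt0 //.
apply: ler_sum_expz_sym; first by rewrite ler_pdivlMr; lra.
apply: ler_pM; rewrite ?invr_ge0 ?lerD2l //; [lra | lra |].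
by rewrite lef_pV2 ?posrE; lra.
Qed.

(** This carries product inequalities from [w] to [w / (1 + w)], the form of the elasticities below.
    Cleared of denominators, the difference of the sides is [(c d - a b) + a (c d - a b) + b (c - a)
    (d - a)]. *)
Lemma ler_odds_mul (R : realFieldType) (a b c d : R) :
  0 <= a -> 0 <= b -> a <= c -> a <= d -> a * b <= c * d ->
  a / (1 + a) * (b / (1 + b)) <= c / (1 + c) * (d / (1 + d)).
Proof.
move=> a0 b0 ac ad abcd.
have c0 : 0 <= c by exact: le_trans ac.
have d0 : 0 <= d by exact: le_trans ad.
rewrite !mulf_div ler_pdivrMr ?mulr_gt0 ?ltr_wpDr // mulrAC.
rewrite ler_pdivlMr ?mulr_gt0 ?ltr_wpDr //.
have h1 : 0 <= b * ((c - a) * (d - a)) by rewrite !mulr_ge0 ?subr_ge0.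
have h2 : 0 <= a * (c * d - a * b) by rewrite mulr_ge0 ?subr_ge0.
by nra.
Qed.

(** * The polynomial [phi] and its dilation inequality *)

Definition evenpart (R : fieldType) (q : nat) : {poly R} :=
  2^-1 *: ((1 + 'X) ^+ q + (1 - 'X) ^+ q).

Lemma evenpartE (R : fieldType) (q : nat) (x : R) :
  (evenpart R q).[x] = ((1 + x) ^+ q + (1 - x) ^+ q) / 2.
Proof. by rewrite /evenpart !hornerE mulrC. Qed.

Lemma evenpart_deriv (R : fieldType) (q : nat) (x : R) :
  (evenpart R q.+1)^`().[x] = q.+1%:R * ((1 + x) ^+ q - (1 - x) ^+ q) / 2.
Proof.
rewrite /evenpart derivZ derivD !deriv_exp derivB derivD derivX -polyC1 derivC.
by rewrite add0r sub0r mulN1r mulNrn !hornerE !hornerMn !hornerE -mulr_natl; ring.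
Qed.

Lemma evenpart0 (R : realFieldType) (q : nat) : (evenpart R q).[0] = 1.
Proof. by rewrite evenpartE addr0 subr0 expr1n; field. Qed.

Lemma evenpart_gt0 (R : realFieldType) (q : nat) (x : R) :
  0 <= x <= 1 -> 0 < (evenpart R q).[x].
Proof. by move=> x01; rewrite evenpartE divr_gt0 ?tanhn_den_gt0. Qed.

(** [(1 + x)^(m+1) + (1 - x)^(m+1)] is [(1 + x)^m + (1 - x)^m] plus [x] times
    [(1 + x)^m - (1 - x)^m]; dividing by the first part gives [1 + w] with [w = x * tanhn R m x]. *)
Lemma evenpart_elasticity (R : realFieldType) (m : nat) (x : R) : 0 <= x <= 1 ->
  x * (evenpart R m.+1)^`().[x] / (evenpart R m.+1).[x] =
  m.+1%:R * (x * tanhn R m x / (1 + x * tanhn R m x)).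
Proof.
move=> x01; rewrite evenpart_deriv evenpartE /tanhn.
have := tanhn_den_gt0 R m x x01; have := tanhn_den_gt0 R m.+1 x x01.
rewrite !exprS; move: (m.+1%:R) ((1 + x) ^+ m) ((1 - x) ^+ m) => k a b p1 p0.
have E : x * ((a - b) / (a + b)) / (1 + x * ((a - b) / (a + b)))
   = x * (a - b) / ((1 + x) * a + (1 - x) * b).
  have -> : 1 + x * ((a - b) / (a + b)) = ((1 + x) * a + (1 - x) * b) / (a + b).
    by field; rewrite gt_eqF.
  by field; rewrite !gt_eqF.
by rewrite E; field; rewrite gt_eqF.
Qed.

Lemma ln_evenpart_dilate_le (R : realType) (n : nat) (r t : R) :
  0 <= r <= 1 -> 0 <= t <= 1 ->
  ln (evenpart R n.+2).[r * t] * ln (evenpart R n.+2).[1]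
    <= ln (evenpart R n.+2).[r] * ln (evenpart R n.+2).[t].
Proof.
move=> /andP[r0 r1] t01; apply: ln_dilate_le => //; last by rewrite r0.
- exact: evenpart0.
- by move=> x; apply: evenpart_gt0.
- move=> x /andP[x0 x1]; rewrite evenpart_deriv divr_gt0 // mulr_gt0 //.
  by rewrite tanhn_num_gt0 // x0 ltW.
move=> x y x0 xy y1.
have x1 : x < 1 by exact: le_lt_trans y1.
have y0 : 0 < y by exact: lt_le_trans xy.
have [->|rn0] := eqVneq r 0; first by rewrite !mul0r.
have {rn0}r0 : 0 < r by rewrite lt_neqAle eq_sym rn0.
have dom (z : R) : 0 < z -> z < 1 -> 0 < r * z < 1.
  by move=> z0 z1; rewrite mulr_gt0 //= (le_lt_trans _ z1) // ler_piMl // ltW.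
have /andP[rx0 rx1] := dom x x0 x1; have /andP[ry0 ry1] := dom y y0 y1.
rewrite !evenpart_elasticity ?(ltW x0) ?(ltW y0) ?(ltW x1) ?(ltW y1)
  ?(ltW rx0) ?(ltW ry0) ?(ltW rx1) ?(ltW ry1) //.
rewrite mulrACA [leRHS]mulrACA ler_pM2l ?mulr_gt0 //.
have tpos (z : R) : 0 < z -> z < 1 -> 0 < tanhn R n.+1 z.
  by move=> z0 z1; rewrite tanhn_gt0 // z0 ltW.
(* With [w(z) = z * tanhn R n.+1 z], the four numbers are [w(r x)], [w(y)], [w(r y)] and [w(x)]. *)
apply: ler_odds_mul.
- by rewrite mulr_ge0 // ltW // tpos.
- by rewrite mulr_ge0 // ltW // tpos.
- by rewrite ler_pM ?(ltW (tpos _ _ _)) ?(ltW rx0) ?ler_tanhn ?ler_pM2l // ltW.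
- have rxx : r * x <= x by rewrite ler_piMl // ltW.
  by rewrite ler_pM ?(ltW (tpos _ _ _)) ?(ltW rx0) ?ler_tanhn // ltW.
(* The linear factors multiply to [r x y] on both sides and cancel. *)
- have := tanhn_supermul R n r x y; rewrite r0 r1 => /(_ isT x0 xy y1) h.
  rewrite mulrACA [leRHS]mulrACA (mulrAC r y x) ler_pM2l //.
  by rewrite !mulr_gt0.
Qed.

(** The elasticity of [1 + x] is [x / (1 + x)], so here [w = x] and the two products in
    [ler_odds_mul] are equal. *)
Lemma ln_linear_dilate_le (R : realType) (r t : R) :
  0 <= r <= 1 -> 0 <= t <= 1 -> ln (1 + r * t) * ln 2 <= ln (1 + r) * ln (1 + t).
Proof.
move=> /andP[r0 r1] t01.
have pE (x : R) : (1 + 'X).[x] = 1 + x by rewrite !hornerE.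
have dpE (x : R) : (1 + 'X)^`().[x] = 1.
  by rewrite derivD derivX -polyC1 derivC add0r polyC1 !hornerE.
have := ln_dilate_le R (1 + 'X) r t; rewrite !pE; apply=> //; last by rewrite r0.
- by rewrite addr0.
- by move=> x /andP[x0 _]; rewrite pE ltr_wpDr.
- by move=> x _; rewrite dpE.
move=> x y x0 xy y1; rewrite !pE !dpE !mulr1.
have y0 : 0 < y by exact: lt_le_trans xy.
have rx0 : 0 <= r * x by rewrite mulr_ge0 // ltW.
apply: ler_odds_mul => //; first exact: ltW.
- by rewrite ler_wpM2l.
- by rewrite ler_piMl // ltW.
- by rewrite mulrAC.
Qed.

Lemma evenpart_le (R : realType) (q : nat) (x y : R) :
  0 <= x -> x <= y -> y <= 1 -> (evenpart R q.+1).[x] <= (evenpart R q.+1).[y].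
Proof.
move=> x0 xy y1; have [->//|xny] := eqVneq x y.
have {xny}xy : x < y by rewrite lt_neqAle xny.
have pder (z : R) : x <= z <= y ->
    is_derive z 1 (horner (evenpart R q.+1)) (evenpart R q.+1)^`().[z].
  by move=> _; apply: is_derive_poly.
have [c /andP[xc cy] eqc] := MVT_is_derive _ _ _ _ _ xy pder.
rewrite -subr_ge0 eqc mulr_ge0 ?subr_ge0 ?(ltW xy) // evenpart_deriv.
rewrite divr_ge0 // mulr_ge0 // subr_ge0 lerXn2r // ?nnegrE; lra.
Qed.

Lemma evenpart1 (R : realFieldType) (q : nat) : (evenpart R q.+1).[1] = 2 ^+ q.
Proof.
rewrite evenpartE subrr expr0n /= addr0 -[1 + 1]/2 exprS.
by rewrite mulrAC divff ?mul1r ?pnatr_eq0.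
Qed.

(** * The exponents lambda *)

Lemma evenpart_noise (R : realFieldType) (q : nat) (eps : R) :
  (evenpart R q.+1).[1 - 2 * eps] = 2 ^+ q * (eps ^+ q.+1 + (1 - eps) ^+ q.+1).
Proof.
rewrite evenpartE.
have -> : 1 + (1 - 2 * eps) = 2 * (1 - eps) by ring.
have -> : 1 - (1 - 2 * eps) = 2 * eps by ring.
rewrite !exprMn exprS.
by field.
Qed.

Lemma noise_power_gt0 (R : realFieldType) (q : nat) (eps : R) :
  0 <= eps -> eps <= 2^-1 -> 0 < eps ^+ q + (1 - eps) ^+ q.
Proof.
by move=> e0 e1; rewrite ltr_wpDl ?exprn_ge0 ?exprn_gt0 // subr_gt0; lra.
Qed.

Lemma ln2_gt0 (R : realType) : 0 < ln 2 :> R.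
Proof. by rewrite ln_gt0 // ltr1n. Qed.

(** Noise shrinks the nonconstant part of a function of one bit by [r = 1 - 2 * eps]. The quotient
    [ln phi(r) / ln phi(1)] is the weight forced by equality at [t = 1], where the function vanishes
    at one of the two points. *)
Lemma lam_qE (R : realType) (n : nat) (eps : R) : 0 <= eps -> eps <= 2^-1 ->
  lam_q n.+2 eps
  = ln (evenpart R n.+2).[1 - 2 * eps] / ln (evenpart R n.+2).[1].
Proof.
move=> e0 e1; have s0 := noise_power_gt0 R n.+2 eps e0 e1.
rewrite evenpart_noise evenpart1 lnM ?posrE ?exprn_gt0 // lnXn // -[ln 2 *+ _]mulr_natl.
rewrite /lam_q /log2 -[n.+2%:R]natr1 addrK.
have k0 : n.+1%:R != 0 :> R by rewrite pnatr_eq0.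
have l0 : ln 2 != 0 :> R by rewrite gt_eqF ?ln2_gt0.
by move: (n.+1%:R) k0 => k k0; field; rewrite l0.
Qed.

(** [phi] is nondecreasing on the unit interval and [phi(0) = 1]. *)
Lemma lam_q_itv (R : realType) (n : nat) (eps : R) :
  0 <= eps -> eps <= 2^-1 -> 0 <= lam_q n.+2 eps <= 1.
Proof.
move=> e0 e1; rewrite lam_qE //.
have r0 : 0 <= 1 - 2 * eps by lra.
have r1 : 1 - 2 * eps <= 1 by lra.
have p1 : 0 < ln (evenpart R n.+2).[1].
  by rewrite evenpart1 ln_gt0 // exprn_egt1 // ltr1n.
have pr0 : 0 < (evenpart R n.+2).[1 - 2 * eps] by rewrite evenpart_gt0 ?r0.
apply/andP; split.
  rewrite divr_ge0 ?(ltW p1) // ln_ge0 //.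
  by rewrite -[leLHS](evenpart0 R n.+2) evenpart_le.
rewrite ler_pdivrMr // mul1r ler_ln ?posrE // ?evenpart_le //.
by rewrite evenpart_gt0 // ler01 lexx.
Qed.

Lemma lam_infE (R : realType) (eps : R) : eps <= 2^-1 ->
  lam_inf eps = ln (1 + (1 - 2 * eps)) / ln 2.
Proof.
move=> e1; have -> : 1 + (1 - 2 * eps) = 2 * (1 - eps) by ring.
rewrite lnM ?posrE ?subr_gt0 //; last lra.
by rewrite /lam_inf /log2; field; rewrite gt_eqF ?ln2_gt0.
Qed.

Lemma lam_inf_itv (R : realType) (eps : R) :
  0 <= eps -> eps <= 2^-1 -> 0 <= lam_inf eps <= 1.
Proof.
move=> e0 e1; rewrite lam_infE //; apply/andP; split.
  by rewrite divr_ge0 ?(ltW (ln2_gt0 R)) // ln_ge0; lra.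
by rewrite ler_pdivrMr ?ln2_gt0 // mul1r ler_ln ?posrE; lra.
Qed.

(** * The inequality for a function of one bit *)

Lemma two_point_q (R : realType) (n : nat) (eps a b : R) :
  let q := n.+2 in
  0 <= eps -> eps <= 2^-1 -> 0 <= a -> 0 <= b -> 0 < a + b ->
  ln ((((1 - eps) * a + eps * b) ^+ q + ((1 - eps) * b + eps * a) ^+ q) / 2)
  <= lam_q q eps * ln ((a ^+ q + b ^+ q) / 2)
     + (1 - lam_q q eps) * ln (((a + b) / 2) ^+ q).
Proof.
move=> q e0 e1.
wlog ba : a b / b <= a => [th|] a0 b0 ab0.
  case/orP: (le_total b a) => h; first exact: th.
  rewrite addrC [a ^+ q + _]addrC [a + b]addrC.
  by apply: th; rewrite // addrC.
(* Noise fixes the mean [M] and multiplies the relative deviation [t] by [r]. The powers of [M]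
   cancel because the weights add up to 1, leaving [phi(r t) <= phi(t)^lambda]. *)
pose M := (a + b) / 2; pose t := (a - b) / (a + b); pose r := 1 - 2 * eps.
have M0 : 0 < M by rewrite divr_gt0.
have abn0 : a + b != 0 by rewrite gt_eqF.
have aE : a = M * (1 + t) by rewrite /M /t; field.
have bE : b = M * (1 - t) by rewrite /M /t; field.
have t0 : 0 <= t by rewrite divr_ge0 ?subr_ge0 // ltW.
have t1 : t <= 1 by rewrite ler_pdivrMr // mul1r lerD2l; lra.
have r01 : 0 <= r <= 1 by rewrite /r; apply/andP; split; lra.
have scale (x : R) :
    ((M * (1 + x)) ^+ q + (M * (1 - x)) ^+ q) / 2 = M ^+ q * (evenpart R q).[x].
  by rewrite evenpartE !exprMn; ring.
have -> : (1 - eps) * a + eps * b = M * (1 + r * t) by rewrite {1}aE {1}bE /r; ring.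
have -> : (1 - eps) * b + eps * a = M * (1 - r * t) by rewrite {1}aE {1}bE /r; ring.
rewrite -/M scale.
have -> : (a ^+ q + b ^+ q) / 2 = M ^+ q * (evenpart R q).[t] by rewrite -scale -aE -bE.
have Mq0 : 0 < M ^+ q by rewrite exprn_gt0.
have rt01 : 0 <= r * t <= 1.
  by case/andP: r01 => r0 r1; rewrite mulr_ge0 // mulr_ile1.
have prt := evenpart_gt0 R q _ rt01.
have pt : 0 < (evenpart R q).[t] by rewrite evenpart_gt0 ?t0.
have lnE (x : R) : 0 < (evenpart R q).[x] ->
    ln (M ^+ q * (evenpart R q).[x]) = ln (M ^+ q) + ln (evenpart R q).[x].
  by move=> px; rewrite lnM.
rewrite (lnE _ prt) (lnE _ pt).
have key : ln (evenpart R q).[r * t] <= lam_q q eps * ln (evenpart R q).[t].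
  rewrite lam_qE // mulrAC ler_pdivlMr ?ln_evenpart_dilate_le ?t0 //.
  by rewrite evenpart1 ln_gt0 // exprn_egt1 // ltr1n.
by move: key; lra.
Qed.

Lemma two_point_inf (R : realType) (eps a b : R) :
  0 <= eps -> eps <= 2^-1 -> 0 <= a -> 0 <= b -> 0 < (1 - eps) * a + eps * b ->
  ln ((1 - eps) * a + eps * b)
  <= lam_inf eps * ln (Num.max a b) + (1 - lam_inf eps) * ln ((a + b) / 2).
Proof.
move=> e0 e1 a0 b0 L0.
have ab0 : 0 < a + b by nra.
suff main (c d : R) : 0 <= d -> d <= c -> 0 < c + d ->
    ln ((1 - eps) * c + eps * d)
    <= lam_inf eps * ln c + (1 - lam_inf eps) * ln ((c + d) / 2).
  case: (leP a b) => [ab|/ltW ba]; last exact: main.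
  have ba0 : 0 < b + a by rewrite addrC.
  (* Since [a <= b] and [eps <= 1 - eps], giving the larger weight to [b] can only increase the left
     side. *)
  apply: le_trans (_ : ln ((1 - eps) * b + eps * a) <= _).
    by rewrite ler_ln ?posrE //; nra.
  by rewrite (addrC a b); exact: main.
move=> d0 dc cd0.
pose M := (c + d) / 2; pose t := (c - d) / (c + d); pose r := 1 - 2 * eps.
have M0 : 0 < M by rewrite divr_gt0.
have cdn0 : c + d != 0 by rewrite gt_eqF.
have cE : c = M * (1 + t) by rewrite /M /t; field.
have dE : d = M * (1 - t) by rewrite /M /t; field.
have t0 : 0 <= t by rewrite divr_ge0 ?subr_ge0 // ltW.
have t1 : t <= 1 by rewrite ler_pdivrMr // mul1r lerD2l; lra.
have r01 : 0 <= r <= 1 by rewrite /r; apply/andP; split; lra.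
have -> : (1 - eps) * c + eps * d = M * (1 + r * t) by rewrite {1}cE {1}dE /r; ring.
rewrite -/M {1}cE.
have rt0 : 0 <= r * t by case/andP: r01 => r0 r1; rewrite mulr_ge0.
have lnE (x : R) : 0 <= x -> ln (M * (1 + x)) = ln M + ln (1 + x).
  by move=> x0; rewrite lnM ?posrE ?ltr_wpDr.
rewrite (lnE _ rt0) (lnE _ t0).
have key : ln (1 + r * t) <= lam_inf eps * ln (1 + t).
  by rewrite lam_infE // mulrAC ler_pdivlMr ?ln2_gt0 // ln_linear_dilate_le ?t0.
by move: key; lra.
Qed.

(** * Hölder's inequality in logarithmic form *)

Lemma geometric_le_arithmetic (R : realType) (l L A B alpha beta : R) :
  0 <= l <= 1 -> 0 < L -> 0 < A -> 0 < B -> 0 < alpha -> 0 < beta ->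
  ln L <= l * ln A + (1 - l) * ln B ->
  L <= expR (l * ln alpha + (1 - l) * ln beta)
       * (l * (A / alpha) + (1 - l) * (B / beta)).
Proof.
move=> /andP[l0 l1] L0 A0 B0 al0 be0 hL.
(* Weighted AM-GM: [1 + y <= exp y] is used at [u - c] and [v - c], whose weighted mean is 0. *)
pose u := ln A - ln alpha; pose v := ln B - ln beta.
pose c := l * u + (1 - l) * v.
have -> : A / alpha = expR c * expR (u - c).
  by rewrite -expRD addrC subrK /u expRB !lnK ?posrE.
have -> : B / beta = expR c * expR (v - c).
  by rewrite -expRD addrC subrK /v expRB !lnK ?posrE.
rewrite !(mulrCA _ (expR c)) -mulrDr mulrA -expRD.
have -> : L = expR (ln L) * 1 by rewrite mulr1 lnK ?posrE.
apply: ler_pM; rewrite ?expR_ge0 ?ler_expR //.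
  by rewrite /c /u /v; lra.
have hu := ler_wpM2l l0 (expR_ge1Dx (u - c)).
have l1' : 0 <= 1 - l by rewrite subr_ge0.
have hv := ler_wpM2l l1' (expR_ge1Dx (v - c)).
by apply: le_trans (lerD hu hv); rewrite /c; lra.
Qed.

(** With [alpha] and [beta] the total sums, the last factors in [geometric_le_arithmetic] add up to
    1 over [i]. Zero values of [L] are set apart, as their logarithm carries no information. *)
Lemma ln_sum_le (R : realType) (I : finType) (l : R) (L A B : I -> R) :
  0 <= l <= 1 -> (forall i, 0 <= A i) -> (forall i, 0 <= B i) ->
  (forall i, L i = 0 \/
    [/\ 0 < L i, 0 < A i, 0 < B i & ln (L i) <= l * ln (A i) + (1 - l) * ln (B i)]) ->
  0 < \sum_i L i -> 0 < \sum_i A i -> 0 < \sum_i B i ->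
  ln (\sum_i L i) <= l * ln (\sum_i A i) + (1 - l) * ln (\sum_i B i).
Proof.
move=> l01 A0 B0 hL sL sA sB; have /andP[l0 l1] := l01.
rewrite -ler_expR lnK ?posrE //; set c := expR _.
have -> : c = \sum_i c * (l * (A i / \sum_i A i) + (1 - l) * (B i / \sum_i B i)).
  rewrite -mulr_sumr big_split /= -!mulr_sumr -!mulr_suml !divff ?gt_eqF //.
  by rewrite !mulr1 subrKC mulr1.
apply: ler_sum => i _; case: (hL i) => [->|[Li Ai Bi hi]].
  by rewrite mulr_ge0 ?expR_ge0 // addr_ge0 // mulr_ge0 ?subr_ge0 // divr_ge0 // ltW.
exact: geometric_le_arithmetic.
Qed.

(** * Noise with a different rate in each direction *)

Definition flip (n : nat) (i : 'I_n) (x : cube n) : cube n :=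
  [ffun j => if j == i then ~~ x j else x j].

Lemma flipK (n : nat) (i : 'I_n) : involutive (flip n i).
Proof.
by move=> x; apply/ffunP => j; rewrite !ffunE; case: eqP => // _; rewrite negbK.
Qed.

Lemma sum_flip (R : nmodType) (n : nat) (i : 'I_n) (F : cube n -> R) :
  \sum_x F (flip n i x) = \sum_x F x.
Proof. by rewrite [RHS](reindex_inj (inv_inj (flipK n i))). Qed.

Definition upd (R : Type) (n : nat) (e : 'I_n -> R) (i : 'I_n) (c : R) : 'I_n -> R :=
  fun j => if j == i then c else e j.

(** One family contains both sides of the theorem: a constant rate gives the noise operator, and
    rates 0 and 1/2 give the conditional expectations. *)
Definition pnoise (R : realType) (n : nat) (e : 'I_n -> R) (f : cube n -> R)
    (x : cube n) : R :=
  \sum_(y : cube n) (\prod_j (if y j == x j then 1 - e j else e j)) * f y.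

(** The kernel is a product, and only its factor in direction [i] sees [c] or the flip. *)
Lemma pnoise_upd (R : realType) (n : nat) (e : 'I_n -> R) (i : 'I_n) (c : R)
    (f : cube n -> R) (x : cube n) :
  pnoise R n (upd R n e i c) f x =
    (1 - c) * pnoise R n (upd R n e i 0) f x
    + c * pnoise R n (upd R n e i 0) f (flip n i x).
Proof.
rewrite /pnoise !mulr_sumr -big_split /=; apply: eq_bigr => y _.
rewrite !mulrA -mulrDl; congr (_ * _).
have D (F : 'I_n -> R) : \prod_j F j = F i * \prod_(j | j != i) F j by rewrite (bigD1 i).
rewrite !D /upd eqxx ffunE eqxx.
set P := \prod_(j | j != i) _; set P1 := \prod_(j | j != i) _; set P2 := \prod_(j | j != i) _.
have -> : P1 = P by apply: eq_bigr => j /negPf ->.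
have -> : P2 = P by apply: eq_bigr => j /negPf ji; rewrite ffunE ji.
by case: (y i); case: (x i); rewrite /=; ring.
Qed.

Lemma pnoise_row_sum (R : realType) (n : nat) (e : 'I_n -> R) (x : cube n) :
  \sum_(y : cube n) \prod_j (if y j == x j then 1 - e j else e j) = 1.
Proof.
rewrite -(bigA_distr_bigA (fun j b => if b == x j then 1 - e j else e j)) /=.
rewrite big1 // => j _; rewrite big_bool /=.
by case: (x j); rewrite /= ?subrK // addrC subrK.
Qed.

Lemma pnoise_ge0 (R : realType) (n : nat) (e : 'I_n -> R) (f : cube n -> R) :
  (forall j, 0 <= e j <= 2^-1) -> (forall x, 0 <= f x) ->
  forall x, 0 <= pnoise R n e f x.
Proof.
move=> he hf x; apply: sumr_ge0 => y _; rewrite mulr_ge0 // prodr_ge0 // => j _.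
by have /andP[h0 h1] := he j; case: ifP => // _; lra.
Qed.

Lemma pnoise_gt0 (R : realType) (n : nat) (e : 'I_n -> R) (f : cube n -> R) (x : cube n) :
  (forall j, 0 <= e j <= 2^-1) -> (forall x, 0 <= f x) ->
  0 < f x -> 0 < pnoise R n e f x.
Proof.
move=> he hf fx; rewrite /pnoise (bigD1 x) //= ltr_wpDr //.
  apply: sumr_ge0 => y _; rewrite mulr_ge0 // prodr_ge0 // => j _.
  by have /andP[h0 h1] := he j; case: ifP => // _; lra.
rewrite mulr_gt0 // prodr_gt0 // => j _; rewrite eqxx.
by have /andP[h0 h1] := he j; lra.
Qed.

Lemma prodr_if_const (R : comNzRingType) (n : nat) (P : pred 'I_n) (a b : R) :
  \prod_j (if P j then a else b) = a ^+ #|[set j | P j]| * b ^+ (n - #|[set j | P j]|).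
Proof.
rewrite big_if /= !prodr_const; congr (_ ^+ _ * _ ^+ _).
  by apply: eq_card => j; rewrite !inE.
transitivity #|~: [set j | P j]|; first by apply: eq_card => j; rewrite !inE.
by rewrite cardsCs setCK card_ord.
Qed.

Lemma noise_pnoise (R : realType) (n : nat) (eps : R) (f : cube n -> R) (x : cube n) :
  noise eps f x = pnoise R n (fun=> eps) f x.
Proof.
apply: eq_bigr => y _; congr (_ * _); rewrite /hamming -prodr_if_const.
by apply: eq_bigr => j _; case: eqP.
Qed.

(** Rate 1/2 makes a coordinate uniform, which averages over it. *)
Definition erasure (R : realType) (n : nat) (T : {set 'I_n}) : 'I_n -> R :=
  fun j => if j \in T then 0 else 2^-1.

Lemma condexp_pnoise (R : realType) (n : nat) (f : cube n -> R) (T : {set 'I_n})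
    (x : cube n) :
  condexp f T x = pnoise R n (erasure R n T) f x.
Proof.
pose c : R := \prod_(j < n) (if j \in T then 1 else 2^-1).
have w (y : cube n) : \prod_j (if y j == x j then 1 - erasure R n T j else erasure R n T j)
    = if y \in agree T x then c else 0.
  rewrite inE; case: ifPn => [/'forall_implyP h|].
    apply: eq_bigr => j _; rewrite /erasure.
    have [jT|jT] := boolP (j \in T); first by rewrite (h j jT) subr0.
    by case: ifP => // _; field.
  rewrite negb_forall => /existsP[j]; rewrite negb_imply => /andP[jT yx].
  by rewrite (bigD1 j) //= (negPf yx) /erasure jT mul0r.
have := pnoise_row_sum R n (erasure R n T) x.
under eq_bigr => y _ do rewrite w.
rewrite -big_mkcond /= sumr_const -mulr_natl => cE.
have A0 : (#|agree T x|)%:R != 0 :> R.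
  by apply/eqP => A0; move: cE; rewrite A0 mul0r => /eqP; rewrite eq_sym oner_eq0.
rewrite /condexp /pnoise; under [RHS]eq_bigr => y _ do rewrite w.
have -> : c = (#|agree T x|)%:R^-1 by apply: (mulfI A0); rewrite cE divff.
rewrite mulr_suml big_mkcond; apply: eq_bigr => y _.
by case: ifP => _; rewrite ?mul0r // mulrC.
Qed.

(** A hybrid argument: the rates [eps] are exchanged one coordinate at a time for a random choice
    between 0 and 1/2. *)
Lemma Esub_interpolate (R : realType) (n : nat) (eps l : R) (Phi : ('I_n -> R) -> R) :
  0 <= eps <= 2^-1 -> 0 <= l <= 1 ->
  (forall e i, (forall j, 0 <= e j <= 2^-1) ->
     Phi (upd R n e i eps) <= l * Phi (upd R n e i 0) + (1 - l) * Phi (upd R n e i 2^-1)) ->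
  Phi (fun=> eps) <= Esub l (fun T => Phi (erasure R n T)).
Proof.
move=> eps01 /andP[l0 l1] step.
have l1' : 0 <= 1 - l by rewrite subr_ge0.
pose W (T : {set 'I_n}) : R := \prod_j (if j \in T then l else 1 - l).
(* The coordinates in [s] have been exchanged, according to [T]; the others still have rate
   [eps]. *)
pose E (s : seq 'I_n) (T : {set 'I_n}) (j : 'I_n) : R :=
  if j \in s then erasure R n T j else eps.
have Edom s T j : 0 <= E s T j <= 2^-1.
  rewrite /E /erasure; case: ifP => // _.
  by case: ifP => _; rewrite ?lexx ?invr_ge0 //= andbT.
have main s : uniq s -> Phi (fun=> eps) <= \sum_T W T * Phi (E s T).
  elim: s => [_|i s IH /= /andP[ins us]].
    rewrite (eq_bigr (fun T => W T * Phi (fun=> eps))) //.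
    rewrite -mulr_suml /W -(bigA_distr _ _ (fun=> l) (fun=> 1 - l)) /=.
    by rewrite big1 ?mul1r // => j _; rewrite addrC subrK.
  apply: (le_trans (IH us)).
  pose W' (T : {set 'I_n}) : R := \prod_(j | j != i) (if j \in T then l else 1 - l).
  have W'U T : W' (i |: T) = W' T.
    by apply: eq_bigr => j ji; rewrite !inE (negPf ji).
  have D (F : 'I_n -> R) : \prod_j F j = F i * \prod_(j | j != i) F j by rewrite (bigD1 i).
  (* Pairing [T] with [i |: T] isolates the choice made at [i]. *)
  have split (G : {set 'I_n} -> R) : \sum_T W T * G T =
      \sum_(T : {set 'I_n} | i \notin T) W' T * (l * G (i |: T) + (1 - l) * G T).
    rewrite (bigID (fun T : {set 'I_n} => i \in T)) /=.
    rewrite (reindex_onto (fun T => i |: T) (fun T => T :\ i)) /=; last first.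
      by move=> T iT; rewrite setD1K.
    rewrite [X in X + _](eq_bigl (fun T : {set 'I_n} => i \notin T)); last first.
      move=> T; rewrite setU11 /=; apply/eqP/idP => [<-|iT]; first by rewrite !inE eqxx.
      by rewrite setU1K.
    rewrite -big_split /=; apply: eq_bigr => T iT.
    rewrite /W !D /=.
    rewrite setU11 (negPf iT) -/(W' _) -/(W' _) W'U.
    by rewrite /=; ring.
  rewrite !split; apply: ler_sum => T iT.
  have EU : E s (i |: T) = E s T.
    apply: boolp.funext => j; rewrite /E /erasure !inE.
    by case: eqP => [->|] //=; rewrite (negPf ins).
  have Ee : E s T = upd R n (E s T) i eps.
    by apply: boolp.funext => j; rewrite /upd; case: eqP => // ->; rewrite /E (negPf ins).
  have E0 : E (i :: s) (i |: T) = upd R n (E s T) i 0.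
    apply: boolp.funext => j; rewrite /upd /E /erasure !inE.
    by case: eqP.
  have E1 : E (i :: s) T = upd R n (E s T) i 2^-1.
    apply: boolp.funext => j; rewrite /upd /E /erasure !inE.
    by case: eqP => // ->; rewrite (negPf iT).
  rewrite EU -mulrDl (addrC l) subrK mul1r E0 E1 ler_wpM2l //.
    by rewrite prodr_ge0 // => j _; case: ifP.
  by rewrite {1}Ee step.
(* Once every coordinate is listed, no rate [eps] is left and [W] is the weight of [Esub]. *)
apply: (le_trans (main _ (enum_uniq 'I_n))); rewrite le_eqVlt; apply/orP; left.
apply/eqP/eq_bigr => T _; rewrite /W prodr_if_const.
congr (_ ^+ _ * _ ^+ (_ - _) * Phi _).
- by apply: eq_card => j; rewrite inE.
- by apply: eq_card => j; rewrite inE.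
- by apply: boolp.funext => j; rewrite /E mem_enum.
Qed.

(** * The one-coordinate inequality *)

Lemma ln_qnorm (R : realType) (n q : nat) (g : cube n -> R) :
  (forall x, 0 <= g x) -> 0 < \sum_x g x ^+ q ->
  ln (qnorm q g) = q%:R^-1 * (ln (\sum_x g x ^+ q) - ln #|{: cube n}|%:R).
Proof.
move=> g0 s0; rewrite /qnorm /cmean ln_powR; congr (_ * _).
under eq_bigr => x _ do rewrite ger0_norm //.
by rewrite ln_div ?posrE // ltr0n; apply/card_gt0P; exists [ffun=> false].
Qed.

Lemma sum_expr_gt0 (R : realType) (n q : nat) (g : cube n -> R) (x : cube n) :
  (forall x, 0 <= g x) -> 0 < g x -> 0 < \sum_x g x ^+ q.
Proof.
move=> g0 gx; rewrite (bigD1 x) //= ltr_wpDr ?exprn_gt0 //.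
by apply: sumr_ge0 => y _; rewrite exprn_ge0.
Qed.

Lemma infnorm_ge (R : realType) (n : nat) (g : cube n -> R) (x : cube n) :
  (forall x, 0 <= g x) -> g x <= infnorm g.
Proof. by move=> g0; apply: le_trans (le_bigmax _ _ x); rewrite ger0_norm. Qed.

Lemma infnorm_le (R : realType) (n : nat) (g : cube n -> R) (c : R) :
  0 <= c -> (forall x, 0 <= g x) -> (forall x, g x <= c) -> infnorm g <= c.
Proof.
by move=> c0 g0 gc; apply: bigmax_le => // x _; rewrite ger0_norm.
Qed.

Lemma infnorm_ge0 (R : realType) (n : nat) (g : cube n -> R) : 0 <= infnorm g.
Proof. exact: bigmax_ge_id. Qed.

(** The operator [N_i] of the overview; at [c = 2^-1] it is [E_i]. *)
Definition mix (R : realType) (n : nat) (i : 'I_n) (c : R) (g : cube n -> R)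
    (x : cube n) : R :=
  (1 - c) * g x + c * g (flip n i x).

Lemma mix_ge0 (R : realType) (n : nat) (i : 'I_n) (c : R) (g : cube n -> R) :
  0 <= c <= 2^-1 -> (forall x, 0 <= g x) -> forall x, 0 <= mix R n i c g x.
Proof.
move=> /andP[c0 c1] g0 x; rewrite addr_ge0 // mulr_ge0 //; lra.
Qed.

Lemma mix_gt0 (R : realType) (n : nat) (i : 'I_n) (c : R) (g : cube n -> R) (x : cube n) :
  0 <= c <= 2^-1 -> (forall x, 0 <= g x) -> 0 < g x -> 0 < mix R n i c g x.
Proof.
move=> /andP[c0 c1] g0 gx; rewrite ltr_wpDr ?mulr_ge0 // mulr_gt0 //; lra.
Qed.

Lemma half_noise_itv (R : realType) : 0 <= (2^-1 : R) <= 2^-1.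
Proof. by rewrite lexx invr_ge0 ler0n. Qed.

Lemma mix_half (R : realType) (n : nat) (i : 'I_n) (g : cube n -> R) (x : cube n) :
  mix R n i 2^-1 g x = (g x + g (flip n i x)) / 2.
Proof. by rewrite /mix; field. Qed.

(** [two_point_q] holds on each pair formed by a point and its flip, and [ln_sum_le] sums over the
    pairs. *)
Lemma ln_qnorm_mix_le (R : realType) (n m : nat) (i : 'I_n) (eps : R) (g : cube n -> R) :
  let q := m.+2 in
  0 <= eps <= 2^-1 -> (forall x, 0 <= g x) -> (exists x, 0 < g x) ->
  ln (qnorm q (mix R n i eps g)) <=
    lam_q q eps * ln (qnorm q g) + (1 - lam_q q eps) * ln (qnorm q (mix R n i 2^-1 g)).
Proof.
move=> q e01 g0 [x0 gx0]; have /andP[e0 e1] := e01.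
have h01 := half_noise_itv R.
have sumL := sum_expr_gt0 R n q _ x0
  (mix_ge0 R n i _ g e01 g0) (mix_gt0 R n i _ g x0 e01 g0 gx0).
have sumB := sum_expr_gt0 R n q _ x0
  (mix_ge0 R n i _ g h01 g0) (mix_gt0 R n i _ g x0 h01 g0 gx0).
have sumA := sum_expr_gt0 R n q _ x0 g0 gx0.
rewrite !ln_qnorm //; [| exact: mix_ge0 | exact: mix_ge0].
(* Each summand becomes a pair average, as [two_point_q] requires; the sum for [mix R n i 2^-1 g]
   stays as it is, being already flip-invariant. *)
have sym (h : cube n -> R) : \sum_x h x = \sum_x (h x + h (flip n i x)) / 2.
  by rewrite -mulr_suml big_split /= sum_flip; field.
have := ln_sum_le R (cube n) (lam_q q eps)
  (fun x => (mix R n i eps g x ^+ q + mix R n i eps g (flip n i x) ^+ q) / 2)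
  (fun x => (g x ^+ q + g (flip n i x) ^+ q) / 2)
  (fun x => mix R n i 2^-1 g x ^+ q).
rewrite -(sym (fun x => mix R n i eps g x ^+ q)) -(sym (fun x => g x ^+ q)).
move=> /(_ (lam_q_itv R m eps e0 e1)) H.
have q0 : 0 <= q%:R^-1 :> R by rewrite invr_ge0.
have main : ln (\sum_x mix R n i eps g x ^+ q) <=
    lam_q q eps * ln (\sum_x g x ^+ q)
    + (1 - lam_q q eps) * ln (\sum_x mix R n i 2^-1 g x ^+ q).
  apply: H => //.
  - by move=> x; rewrite divr_ge0 // addr_ge0 // exprn_ge0.
  - by move=> x; rewrite exprn_ge0 // mix_ge0.
  move=> x; rewrite mix_half {1 2}/mix flipK.
  set a := g x; set b := g (flip n i x).
  have a0 : 0 <= a by exact: g0.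
  have b0 : 0 <= b by exact: g0.
  have [ab|abn] := eqVneq (a + b) 0.
    left; have -> : a = 0 by lra.
    have -> : b = 0 by lra.
    by rewrite !mulr0 addr0 !expr0n /= addr0 mul0r.
  have ab0 : 0 < a + b by rewrite lt_neqAle eq_sym abn addr_ge0.
  right; rewrite /mix flipK -/a -/b.
  have pos2 (c d : R) : 0 <= c -> 0 <= d -> 0 < c + d -> 0 < (c ^+ q + d ^+ q) / 2.
    move=> c0 d0 cd0; rewrite divr_gt0 //.
    have [cp|cn] := ltP 0 c; first by rewrite ltr_wpDr ?exprn_ge0 ?exprn_gt0.
    by rewrite ltr_wpDl ?exprn_ge0 ?exprn_gt0 //; lra.
  split.
  - by apply: pos2; nra.
  - exact: pos2.
  - by rewrite exprn_gt0 // divr_gt0.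
  - exact: two_point_q.
(* The terms in [ln #|{: cube n}|%:R] cancel, the weights adding up to 1. *)
have := ler_wpM2l q0 main; lra.
Qed.

(** No Hölder step occurs: [two_point_inf] is applied at each point, where the maximum and the mean
    of the pair are bounded by the two norms on the right. *)
Lemma ln_infnorm_mix_le (R : realType) (n : nat) (i : 'I_n) (eps : R) (g : cube n -> R) :
  0 <= eps <= 2^-1 -> (forall x, 0 <= g x) -> (exists x, 0 < g x) ->
  ln (infnorm (mix R n i eps g)) <=
    lam_inf eps * ln (infnorm g) + (1 - lam_inf eps) * ln (infnorm (mix R n i 2^-1 g)).
Proof.
move=> e01 g0 [x0 gx0]; have /andP[e0 e1] := e01.
have h01 := half_noise_itv R.
have /andP[l0 l1] := lam_inf_itv R eps e0 e1.
have infA : 0 < infnorm g by apply: lt_le_trans (infnorm_ge R n g x0 g0).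
have m0 := mix_ge0 R n i _ g e01 g0; have h0 := mix_ge0 R n i _ g h01 g0.
have infL : 0 < infnorm (mix R n i eps g).
  by apply: lt_le_trans (infnorm_ge R n _ x0 m0); exact: mix_gt0.
have infB : 0 < infnorm (mix R n i 2^-1 g).
  by apply: lt_le_trans (infnorm_ge R n _ x0 h0); exact: mix_gt0.
rewrite -ler_expR lnK ?posrE //; apply: infnorm_le; rewrite ?expR_ge0 // => x.
have [->|Ln] := eqVneq (mix R n i eps g x) 0; first exact: expR_ge0.
have L0 : 0 < mix R n i eps g x by rewrite lt_neqAle eq_sym Ln m0.
rewrite -[leLHS]lnK ?posrE // ler_expR.
apply: le_trans (two_point_inf R eps _ _ e0 e1 (g0 _) (g0 _) L0) _.
have a0 := g0 x; have b0 := g0 (flip n i x).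
have ab0 : 0 < g x + g (flip n i x) by move: L0; rewrite /mix; nra.
apply: lerD; apply: ler_wpM2l; rewrite ?subr_ge0 //; rewrite ler_ln ?posrE //.
- by rewrite ge_max !infnorm_ge.
- by rewrite lt_max; apply/orP; case: (ltP 0 (g x)) => h; [left | right; lra].
- by rewrite -mix_half infnorm_ge.
- by rewrite divr_gt0.
Qed.

(* The equality cases of [ln_qnorm_mix_le] and [ln_infnorm_mix_le]. *)
Definition pinned_or_free (R : realType) (n : nat) (i : 'I_n) (g : cube n -> R) :=
  (forall x, g (flip n i x) = g x) \/ (forall x, g x * g (flip n i x) = 0).

Lemma mix_free (R : realType) (n : nat) (i : 'I_n) (c : R) (g : cube n -> R) :
  (forall x, g (flip n i x) = g x) -> mix R n i c g = g.
Proof. by move=> h; apply: boolp.funext => x; rewrite /mix h; ring. Qed.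

(** At most one of the two mixed values is nonzero, so the power has no cross terms. *)
Lemma sum_mix_pinned (R : realType) (n q : nat) (i : 'I_n) (c : R) (g : cube n -> R) :
  (forall x, g x * g (flip n i x) = 0) ->
  \sum_x mix R n i c g x ^+ q.+1 = (c ^+ q.+1 + (1 - c) ^+ q.+1) * \sum_x g x ^+ q.+1.
Proof.
move=> h.
have E x : mix R n i c g x ^+ q.+1 =
    (1 - c) ^+ q.+1 * g x ^+ q.+1 + c ^+ q.+1 * g (flip n i x) ^+ q.+1.
  have /eqP := h x; rewrite mulf_eq0 /mix => /orP[] /eqP ->.
    by rewrite mulr0 add0r expr0n /= mulr0 add0r exprMn.
  by rewrite mulr0 addr0 expr0n /= mulr0 addr0 exprMn.
under eq_bigr => x _ do rewrite E.
rewrite big_split /= -!mulr_sumr (sum_flip R n i (fun x => g x ^+ q.+1)).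
by ring.
Qed.

(** In the free case mixing changes nothing. In the pinned case it multiplies the power sum by
    [2^((lambda - 1) (q - 1))], and by [2^(-(q - 1))] at rate 1/2, so the logarithms balance. *)
Lemma ln_qnorm_mix_eq (R : realType) (n m : nat) (i : 'I_n) (eps : R) (g : cube n -> R) :
  let q := m.+2 in
  0 <= eps <= 2^-1 -> (forall x, 0 <= g x) -> (exists x, 0 < g x) ->
  pinned_or_free R n i g ->
  ln (qnorm q (mix R n i eps g)) =
    lam_q q eps * ln (qnorm q g) + (1 - lam_q q eps) * ln (qnorm q (mix R n i 2^-1 g)).
Proof.
move=> q e01 g0 [x0 gx0] []h; first by rewrite !mix_free // -mulrDl; ring.
have h01 := half_noise_itv R; have /andP[e0 e1] := e01.
have sumL := sum_expr_gt0 R n q _ x0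
  (mix_ge0 R n i _ g e01 g0) (mix_gt0 R n i _ g x0 e01 g0 gx0).
have sumB := sum_expr_gt0 R n q _ x0
  (mix_ge0 R n i _ g h01 g0) (mix_gt0 R n i _ g x0 h01 g0 gx0).
have sumA := sum_expr_gt0 R n q _ x0 g0 gx0.
rewrite !ln_qnorm //; [| exact: mix_ge0 | exact: mix_ge0].
have se := noise_power_gt0 R q eps e0 e1.
have sh := noise_power_gt0 R q 2^-1 (proj1 (andP h01)) (lexx _).
rewrite !sum_mix_pinned //.
rewrite (lnM (x := eps ^+ q + _)) ?posrE // (lnM (x := 2^-1 ^+ q + _)) ?posrE //.
have -> : ln (2^-1 ^+ q + (1 - 2^-1) ^+ q) = - (m.+1%:R * ln 2) :> R.
  have -> : 1 - 2^-1 = 2^-1 :> R by field.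
  have -> : 2^-1 ^+ q + 2^-1 ^+ q = (2 ^+ m.+1)^-1 :> R.
    by rewrite -exprVn /q (exprS _ m.+1); field.
  by rewrite lnV ?posrE ?exprn_gt0 // lnXn // mulr_natl.
have -> : ln (eps ^+ q + (1 - eps) ^+ q) = (lam_q q eps - 1) * (m.+1%:R * ln 2).
  rewrite /lam_q /log2 -[q%:R]natr1 addrK.
  have k0 : m.+1%:R != 0 :> R by rewrite pnatr_eq0.
  have l0 : ln 2 != 0 :> R by rewrite gt_eqF ?ln2_gt0.
  by move: (m.+1%:R) k0 => k k0; field; rewrite l0.
by ring.
Qed.

Lemma infnorm_mix_pinned (R : realType) (n : nat) (i : 'I_n) (c : R) (g : cube n -> R) :
  0 <= c <= 2^-1 -> (forall x, 0 <= g x) -> (forall x, g x * g (flip n i x) = 0) ->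
  infnorm (mix R n i c g) = (1 - c) * infnorm g.
Proof.
move=> c01 g0 h; have /andP[c0 c1] := c01.
have G0 := infnorm_ge0 R n g; have c1' : 0 <= 1 - c by lra.
apply/le_anti/andP; split.
  apply: infnorm_le; [exact: mulr_ge0 | exact: mix_ge0 | move=> x].
  have gx := infnorm_ge R n g x g0; have gf := infnorm_ge R n g (flip n i x) g0.
  have /eqP := h x; rewrite mulf_eq0 /mix => /orP[] /eqP ->.
    (* Only the flipped point contributes here, with weight [c <= 1 - c]. *)
    by rewrite mulr0 add0r ler_pM //; lra.
  by rewrite mulr0 addr0 ler_wpM2l.
have c1p : 0 < 1 - c by lra.
rewrite mulrC -ler_pdivlMr //; apply: infnorm_le => // [|x].
  by rewrite divr_ge0 ?infnorm_ge0.
rewrite ler_pdivlMr // mulrC.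
apply: le_trans (infnorm_ge R n _ x (mix_ge0 R n i _ g c01 g0)).
by rewrite /mix lerDl mulr_ge0.
Qed.

(** In the pinned case the factors are [1 - eps = 2^(lambda - 1)] and [1/2]. *)
Lemma ln_infnorm_mix_eq (R : realType) (n : nat) (i : 'I_n) (eps : R) (g : cube n -> R) :
  0 <= eps <= 2^-1 -> (forall x, 0 <= g x) -> (exists x, 0 < g x) ->
  pinned_or_free R n i g ->
  ln (infnorm (mix R n i eps g)) =
    lam_inf eps * ln (infnorm g) + (1 - lam_inf eps) * ln (infnorm (mix R n i 2^-1 g)).
Proof.
move=> e01 g0 [x0 gx0] []h; first by rewrite !mix_free // -mulrDl; ring.
have h01 := half_noise_itv R; have /andP[e0 e1] := e01.
have infA : 0 < infnorm g by apply: lt_le_trans (infnorm_ge R n g x0 g0).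
rewrite !infnorm_mix_pinned //.
have l0 : ln 2 != 0 :> R by rewrite gt_eqF ?ln2_gt0.
have e1' : 0 < 1 - eps by lra.
have -> : 1 - 2^-1 = 2^-1 :> R by field.
have lnE (c : R) : 0 < c -> ln (c * infnorm g) = ln c + ln (infnorm g).
  by move=> c0; rewrite lnM.
have h0 : 0 < 2^-1 :> R by rewrite invr_gt0.
rewrite (lnE _ e1') (lnE _ h0).
by rewrite lnV ?posrE // /lam_inf /log2; field.
Qed.

(** * From one coordinate to all coordinates *)

Lemma pnoise_upd_mix (R : realType) (n : nat) (e : 'I_n -> R) (i : 'I_n) (c : R)
    (f : cube n -> R) :
  pnoise R n (upd R n e i c) f = mix R n i c (pnoise R n (upd R n e i 0) f).
Proof. by apply: boolp.funext => x; rewrite pnoise_upd. Qed.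

(** The condition [e i = 0] says that direction [i] carries no noise yet, so that mixing in it sets
    its rate. *)
Lemma noise_interpolate (R : realType) (n : nat) (eps l : R) (f : cube n -> R)
    (K : (cube n -> R) -> R) :
  0 <= eps <= 2^-1 -> 0 <= l <= 1 ->
  (forall e i, (forall j, 0 <= e j <= 2^-1) -> e i = 0 ->
     K (mix R n i eps (pnoise R n e f)) <=
     l * K (pnoise R n e f) + (1 - l) * K (mix R n i 2^-1 (pnoise R n e f))) ->
  K (noise eps f) <= Esub l (fun T => K (condexp f T)).
Proof.
move=> e01 l01 step.
have -> : noise eps f = pnoise R n (fun=> eps) f.
  by apply: boolp.funext => x; rewrite noise_pnoise.
have -> : (fun T => K (condexp f T)) = (fun T => K (pnoise R n (erasure R n T) f)).
  apply: boolp.funext => T; congr K.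
  by apply: boolp.funext => x; rewrite condexp_pnoise.
apply: (Esub_interpolate R n eps l (fun e => K (pnoise R n e f))) => // e i he.
rewrite (pnoise_upd_mix R n e i eps) (pnoise_upd_mix R n e i 2^-1).
apply: step => [j|]; last by rewrite /upd eqxx.
by rewrite /upd; case: eqP => _ //; rewrite lexx invr_ge0 ler0n.
Qed.

Lemma noise_interpolate_eq (R : realType) (n : nat) (eps l : R) (f : cube n -> R)
    (K : (cube n -> R) -> R) :
  0 <= eps <= 2^-1 -> 0 <= l <= 1 ->
  (forall e i, (forall j, 0 <= e j <= 2^-1) -> e i = 0 ->
     K (mix R n i eps (pnoise R n e f)) =
     l * K (pnoise R n e f) + (1 - l) * K (mix R n i 2^-1 (pnoise R n e f))) ->
  K (noise eps f) = Esub l (fun T => K (condexp f T)).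
Proof.
move=> e01 l01 step; apply/le_anti/andP; split.
  by apply: noise_interpolate => // e i he ei; rewrite step.
(* Equality in each step lets the interpolation be applied to [- K] as well. *)
have : - K (noise eps f) <= Esub l (fun T => - K (condexp f T)).
  apply: (noise_interpolate R n eps l f (fun g => - K g)) => // e i he ei.
  by rewrite step // !mulrN opprD.
rewrite -lerN2 opprK; apply: le_trans; rewrite /Esub -sumrN.
by apply: ler_sum => T _; rewrite mulrN opprK.
Qed.

(** For [i] in [K], a kernel of rate 0 at [i] preserves that bit, so the value vanishes unless
    [x i = a i]. For [i] outside [K], flipping both arguments of the kernel leaves it and the
    indicator unchanged. *)
Lemma pnoise_subcube (R : realType) (n : nat) (K : {set 'I_n}) (a : cube n)
    (e : 'I_n -> R) (i : 'I_n) : e i = 0 ->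
  pinned_or_free R n i (pnoise R n e (subcube_ind R K a)).
Proof.
move=> ei; have [iK|iK] := boolP (i \in K).
  right => x.
  have vanish (z : cube n) : z i != a i -> pnoise R n e (subcube_ind R K a) z = 0.
    move=> zi; apply: big1 => y _; rewrite /subcube_ind.
    case: ifP => [/'forall_implyP h|_]; last by rewrite mulr0.
    rewrite (bigD1 i) //= ei (eqP (h i iK)) eq_sym (negPf zi).
    by rewrite !mul0r.
  have [xi|xi] := eqVneq (x i) (a i); last by rewrite vanish ?mul0r.
  by rewrite (vanish (flip n i x)) ?mulr0 // ffunE eqxx xi; case: (a i).
left => x; rewrite /pnoise -[LHS](sum_flip R n i); apply: eq_bigr => y _.
congr (_ * _).
  apply: eq_bigr => j _; rewrite !ffunE; case: (j == i) => //.
  by case: (y j); case: (x j).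
rewrite /subcube_ind; congr (if _ then _ else _).
apply: eq_forallb_in => j jK; rewrite ffunE; case: (eqVneq j i) => // ji.
by move: iK; rewrite -ji jK.
Qed.

Theorem theorem1p1 (R : realType) (n : nat) (hn : (1 <= n)%N) (eps : R)
  (heps0 : 0 <= eps) (heps1 : eps <= 2^-1)
  (f : cube n -> R) (hf : forall x, 0 <= f x) (hnz : exists x, f x != 0) :
  (forall q : nat, (2 <= q)%N ->
     ln (qnorm q (noise eps f)) <=
     Esub (lam_q q eps) (fun T => ln (qnorm q (condexp f T)))) /\
  (ln (infnorm (noise eps f)) <=
     Esub (lam_inf eps) (fun T => ln (infnorm (condexp f T)))) /\
  ((exists (K : {set 'I_n}) (a : cube n), forall x, f x = subcube_ind R K a x) ->
     (forall q : nat, (2 <= q)%N ->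
        ln (qnorm q (noise eps f)) =
        Esub (lam_q q eps) (fun T => ln (qnorm q (condexp f T)))) /\
     (ln (infnorm (noise eps f)) =
        Esub (lam_inf eps) (fun T => ln (infnorm (condexp f T))))).
Proof.
have e01 : 0 <= eps <= 2^-1 by rewrite heps0.
(* Every intermediate function is nonnegative and not identically zero, as the one-coordinate lemmas
   require. *)
have pos e : (forall j, 0 <= e j <= 2^-1) ->
    (forall x, 0 <= pnoise R n e f x) /\ exists x, 0 < pnoise R n e f x.
  move=> he; split; first exact: pnoise_ge0.
  have [x fx] := hnz; exists x; apply: pnoise_gt0 => //.
  by rewrite lt_neqAle eq_sym fx hf.
split=> [[|[|m]] // _|].
  apply: (noise_interpolate R n eps _ f (fun g => ln (qnorm m.+2 g))) => //.
    exact: lam_q_itv.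
  by move=> e i he _; have [p0 p1] := pos e he; apply: ln_qnorm_mix_le.
split.
  apply: (noise_interpolate R n eps _ f (fun g => ln (infnorm g))) => //.
    exact: lam_inf_itv.
  by move=> e i he _; have [p0 p1] := pos e he; apply: ln_infnorm_mix_le.
move=> [K [a fE]].
have fK : f = subcube_ind R K a by apply: boolp.funext.
have pinned e i : e i = 0 -> pinned_or_free R n i (pnoise R n e f).
  by rewrite fK; exact: pnoise_subcube.
split=> [[|[|m]] // _|].
  apply: (noise_interpolate_eq R n eps _ f (fun g => ln (qnorm m.+2 g))) => //.
    exact: lam_q_itv.
  move=> e i he ei; have [p0 p1] := pos e he.
  by apply: ln_qnorm_mix_eq => //; exact: pinned.
apply: (noise_interpolate_eq R n eps _ f (fun g => ln (infnorm g))) => //.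
  exact: lam_inf_itv.
move=> e i he ei; have [p0 p1] := pos e he.
by apply: ln_infnorm_mix_eq => //; exact: pinned.
Qed.
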